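(* Let $V$ be a vector space over a field, let $W$ be a subspace of $V$, and let $\mathbb{S}(W)$ be a subsemigroup of $L(W)$. Then $L_{\mathbb{S}(W)}(V)$ is a regular semigroup if and only if one of the following holds: (i) $\mathbb{S}(W)$ is a subgroup of $\mathrm{Aut}(W)$; (ii) $\mathbb{S}(W)$ is regular and $W=V$.
   Context: Semigroups (hence subsemigroups) are nonempty. For a vector space $U$, $L(U)$ is the semigroup of all linear maps $U\to U$ under composition (composed from left to right, with $vf$ denoting the image of $v$ under $f$), and $\mathrm{Aut}(U)$ is the group of all linear automorphisms of $U$. For $f\in L(V)$ with $Wf\subseteq W$, $f_{\upharpoonright_W}\in L(W)$ denotes the linear map $W\to W$ that agrees with $f$ on $W$. Define $L_{\mathbb{S}(W)}(V)=\{f\in L(V) : Wf\subseteq W \text{ and } f_{\upharpoonright_W}\in\mathbb{S}(W)\}$, a subsemigroup of $L(V)$. A semigroup $S$ is regular if for every $a\in S$ there is $b\in S$ with $aba=a$. *)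

(* Defs.v *)
From HB Require Import structures.
From mathcomp Require Import all_boot all_algebra.
From mathcomp Require Import boolp classical_sets.

Set Implicit Arguments.
Unset Strict Implicit.
Unset Printing Implicit Defensive.

Import GRing.Theory.
Local Open Scope ring_scope.
Local Open Scope classical_set_scope.

Section Semigroups.

Definition mul_stable (S : semigroupType) (A : set S) : Prop :=
  forall x y, A x -> A y -> A (x * y)%g.

Definition subsemigroup (S : semigroupType) (A : set S) : Prop :=
  A !=set0 /\ mul_stable A.

Definition regular_semigroup (S : semigroupType) (A : set S) : Prop :=
  subsemigroup A /\
  forall a, A a -> exists2 b, A b & (a * b * a)%g = a.

(* [A] is a subgroup of the group [G], where [G] consists of units of [M]. *)
Definition subgroup_of (M : monoidType) (G A : set M) : Prop :=
  [/\ A `<=` G, A 1%g, mul_stable A &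
      forall x, A x -> exists2 y, A y & (x * y = 1)%g /\ (y * x = 1)%g].

End Semigroups.

Section LinearSemigroup.
Variables (F : fieldType) (U : lmodType F).

Definition Lin : Type := {linear U -> U}.

HB.instance Definition _ := gen_eqMixin Lin.
HB.instance Definition _ := gen_choiceMixin Lin.

(* Maps are composed from left to right: v (f g) = (v f) g. *)
Definition Lin_mul (f g : Lin) : Lin := g \o f.
Definition Lin_one : Lin := idfun.

Lemma Lin_eqP (f g : Lin) : f =1 g -> f = g.
Proof.
case: f g => [f [[f1] [f2]]] [g [[g1] [g2]]] /= /funext fg.
move: f1 f2 g1 g2; rewrite fg => f1 f2 g1 g2.
by rewrite (Prop_irrelevance f1 g1) (Prop_irrelevance f2 g2).
Qed.

Lemma Lin_mulA : associative Lin_mul.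
Proof. by move=> f g h; apply: Lin_eqP. Qed.

Lemma Lin_mul1 : left_id Lin_one Lin_mul.
Proof. by move=> f; apply: Lin_eqP. Qed.

Lemma Lin_mulr1 : right_id Lin_one Lin_mul.
Proof. by move=> f; apply: Lin_eqP. Qed.

HB.instance Definition _ := isMonoid.Build Lin Lin_mulA Lin_mul1 Lin_mulr1.

Definition LinAut : set Lin := [set f : Lin | bijective f].

End LinearSemigroup.

(* A subspace of [V] is a [W : submodClosed V]. It is a boolean predicate, but
   with the classical axioms of [boolp] every Prop-valued one is of this form. *)
Section Subspace.
Variables (F : fieldType) (V : lmodType F) (W : submodClosed V).

Record subspace_type : predArgType :=
  SubspaceType { subspace_val : V; _ : subspace_val \in W }.

HB.instance Definition _ := [isSub for subspace_val].
HB.instance Definition _ := [Choice of subspace_type by <:].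
HB.instance Definition _ := [SubChoice_isSubLmodule of subspace_type by <:].

Definition preserves (f : Lin V) : Prop := forall v, v \in W -> f v \in W.

Definition restriction_fun (f : Lin V) (fW : preserves f) (w : subspace_type) :
    subspace_type :=
  SubspaceType (fW (val w) (valP w)).

Lemma restriction_fun_linear (f : Lin V) (fW : preserves f) :
  linear (restriction_fun fW).
Proof. by move=> a u v; apply: val_inj; rewrite /= !linearP. Qed.

HB.instance Definition _ (f : Lin V) (fW : preserves f) :=
  GRing.isLinear.Build F subspace_type subspace_type _ (restriction_fun fW)
    (restriction_fun_linear fW).

Definition restriction (f : Lin V) (fW : preserves f) : Lin subspace_type :=
  restriction_fun fW.

Definition Lin_restr (S : set (Lin subspace_type)) : set (Lin V) :=
  [set f | exists fW : preserves f, S (restriction fW)].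

End Subspace.

(* Main.v *)
(** By Zorn's lemma every linear map [f] has a linear [c] that inverts it on its
    image; applied to inclusions this also gives projections and functionals.
    If [S] is a group, [f] restricts to [g] in [S] and [P] projects onto [W],
    then [P g^-1 + (1 - P) c] is an inverse of [f] in [Lin_restr S] (products
    are composed from left to right). Conversely, for [v] outside [W], every [g]
    in [S] extends to a map sending [v - v P] to an arbitrary [w] in [W], and
    regularity of that extension puts [w] in the image of [g]; so all members of
    [S] are onto, and surjectivity turns [g g' g = g] into [g' g = 1], where
    [g'] is again onto. *)
Require Import Defs.
From HB Require Import structures.
From mathcomp Require Import all_boot all_algebra.
From mathcomp Require Import boolp classical_sets.

Set Implicit Arguments.
Unset Strict Implicit.
Unset Printing Implicit Defensive.

Import GRing.Theory.
Local Open Scope ring_scope.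
Local Open Scope classical_set_scope.

(** * Generalized inverses of linear maps by Zorn's lemma *)

Section GeneralizedInverse.
Variables (F : fieldType) (U V : lmodType F) (f : {linear U -> V}).

(* Closure under [a *: p + q] only, so that the empty set, the union of the
   empty chain, qualifies. *)
Definition partial_ginv (G : set (V * U)) : Prop :=
  [/\ forall a p q, G p -> G q -> G (a *: p + q),
      forall u, G (0, u) -> u = 0 &
      forall x u, G (f x, u) -> f u = f x].

Lemma partial_ginv_bigcup (C : set (set (V * U))) :
  C `<=` partial_ginv -> total_on C subset ->
  partial_ginv (\bigcup_(G in C) G).
Proof.
move=> CP Ctot; split=> [a p q [G CG Gp] [H CH Hq]|u [G /CP[_ G0 _]]|
    x u [G /CP[_ _ Gf]]]; [|exact: G0|exact: Gf].
have [GH|HG] := Ctot _ _ CG CH.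
  by exists H => //; have [Hl _ _] := CP _ CH; apply: Hl => //; apply: GH.
by exists G => //; have [Gl _ _] := CP _ CG; apply: Gl => //; apply: HG.
Qed.

Lemma partial_ginv0 : partial_ginv [set 0].
Proof.
split=> [a p q -> ->|u [->]|x u [-> ->]] //=; first by rewrite scaler0 addr0.
by rewrite linear0.
Qed.

Section Extend.
Variables (A : set (V * U)) (y : V) (u : U).
Hypotheses (PA : partial_ginv A) (A0 : A 0).
Hypothesis yA : ~ exists u', A (y, u').

Let scaleA a p : A p -> A (a *: p).
Proof. by case: PA => Al _ _ Ap; rewrite -[_ *: _]addr0; apply: Al. Qed.

(** The new relation is [A] plus the line through [(y, u)]. A pair with nonzero coefficient can be
    rescaled to coefficient 1: over 0 it would put [y] in the domain of [A], and over the image of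
    [f] it falls under the condition on [u]. *)
Lemma partial_ginv_extend :
  (forall d e x, A (d, e) -> y + d = f x -> f (u + e) = f x) ->
  partial_ginv [set p | exists a, A (p - a *: (y, u))].
Proof.
have [Al AU Af] := PA => uP; split=> [a p q [b Ap] [c Aq]|w [b]|x w [b]] /=.
- exists (a * b + c).
  suff -> : a *: p + q - (a * b + c) *: (y, u) =
            a *: (p - b *: (y, u)) + (q - c *: (y, u)) by apply: Al.
  by rewrite scalerBr scalerDl scalerA opprD addrACA.
- have [->|b0] := eqVneq b 0; first by rewrite scale0r subr0; exact: AU.
  move=> /(scaleA (- b^-1)) Ay; case: yA; exists (- b^-1 *: (w - b *: u)).
  suff <- : - b^-1 *: ((0, w) - b *: (y, u)) = (y, - b^-1 *: (w - b *: u)) by [].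
  congr pair => /=.
  by rewrite sub0r scaleNr scalerN opprK scalerA mulVf // scale1r.
- have [->|b0] := eqVneq b 0; first by rewrite scale0r subr0; exact: Af.
  move=> /(scaleA b^-1) Ad.
  have /= := uP _ _ (b^-1 *: x) Ad.
  rewrite !scalerBr !scalerA mulVf // !scale1r ![_ + (_ - _)]addrC !subrK.
  rewrite !linearZ => /(_ erefl) /(congr1 ( *:%R b)).
  by rewrite !scalerA mulfV // !scale1r.
Qed.

End Extend.

Lemma total_partial_ginv :
  exists2 A, partial_ginv A & forall y, exists u, A (y, u).
Proof.
have [A [PA Amax]] := Zorn_bigcup partial_ginv_bigcup.
(* A maximal relation is nonempty, since [[set 0]] properly contains the empty one. *)
have A0 : A 0.
  apply: contrapT => nA0; apply: (Amax [set 0]); last exact: partial_ginv0.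
  have [Al _ _] := PA.
  have A_empty p : ~ A p.
    by move=> Ap; apply: nA0; rewrite -(addNr p) -scaleN1r; exact: Al.
  by split=> [p /A_empty //|/(_ 0 erefl)].
exists A => // y; apply: contrapT => yA.
have [Al _ Af] := PA.
have [u uP] : exists u,
    forall d e x, A (d, e) -> y + d = f x -> f (u + e) = f x.
  have [[[d e] [x [/= Ade yd]]]|no] :=
      pselect (exists p : V * U, exists x, A p /\ y + p.1 = f x); last first.
    by exists 0 => d e x Ade yd; case: no; exists (d, e), x.
  (* One pair [(d, e)] determines [u] modulo the kernel of [f]. Any other pair differs from it by an
     element of [A] over [f (x' - x)], where [A] already inverts [f]. *)
  exists (x - e) => d' e' x' Ade' yd'.
  have /Af : A (f (x' - x), e' - e).
    suff -> : (f (x' - x), e' - e) = -1 *: (d, e) + (d', e') by exact: Al.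
    congr pair => /=; last by rewrite scaleN1r addrC.
    by rewrite linearB -yd -yd' scaleN1r addrC opprD addrACA addNr add0r.
  by move=> fe; rewrite addrAC -addrA linearD fe -linearD addrC subrK.
apply: (Amax _ _ (partial_ginv_extend PA A0 yA uP)); split.
  by move=> p Ap; exists 0; rewrite scale0r subr0.
by move=> BA; apply: yA; exists u; apply: BA; exists 1; rewrite scale1r subrr.
Qed.

Lemma linear_ginv : exists c : {linear V -> U}, forall x, f (c (f x)) = f x.
Proof.
have [A [Al AU Af] /choice[c Ac]] := total_partial_ginv.
(* The defect of linearity is related to 0 by [A], hence vanishes. *)
have cl : linear c.
  move=> a y z; apply/eqP; rewrite -subr_eq0 -opprB oppr_eq0; apply/eqP/AU.
  suff -> : (0, a *: c y + c z - c (a *: y + z)) =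
      -1 *: (a *: y + z, c (a *: y + z)) + (a *: (y, c y) + (z, c z)).
    exact: Al (Ac _) (Al _ _ _ (Ac _) (Ac _)).
  by congr pair => /=; rewrite scaleN1r ?addNr // addrC.
pose cL : {linear V -> U} :=
  HB.pack_for {linear V -> U} c (GRing.isLinear.Build F V U _ c cl).
by exists cL => x; apply: Af; exact: Ac.
Qed.

End GeneralizedInverse.

(** The map sending [a] to [a *: v] is injective, so a generalized inverse of it sends [v] to 1. *)
Lemma linear_functional_at (F : fieldType) (V : lmodType F) (v : V) :
  v != 0 -> exists phi : {linear V -> F^o}, phi v = 1.
Proof.
move=> v0; have sl : linear (fun a : F^o => a *: v).
  by move=> a b c; rewrite scalerDl scalerA.
pose s : {linear F^o -> V} :=
  HB.pack_for {linear F^o -> V} (fun a : F^o => a *: v)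
    (GRing.isLinear.Build F _ _ _ _ sl).
have [phi /(_ 1)] := linear_ginv s; rewrite /= scale1r => phiv.
exists phi; apply/eqP; rewrite -subr_eq0.
have : (phi v - 1) *: v == 0 by rewrite scalerBl phiv scale1r subrr.
by rewrite scaler_eq0 (negPf v0) orbF.
Qed.

(** * Restriction to the subspace and extension from it *)

Section Restriction.
Variables (F : fieldType) (V : lmodType F) (W : submodClosed V).
Local Notation sW := (subspace_type W).
Implicit Types (S : set (Lin sW)) (f : Lin V) (g : Lin sW) (w : sW).

Lemma subspace_projection :
  exists P : {linear V -> sW}, forall w, P (val w) = w.
Proof.
have [P valP] := linear_ginv (val : {linear sW -> V}).
by exists P => w; apply: val_inj; exact: valP.
Qed.

(** Replaces the restriction, which depends on a proof of invariance, by a pointwise equation. *)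
Lemma Lin_restrP S f :
  Lin_restr S f <-> exists2 g, S g & forall w, f (val w) = val (g w).
Proof.
split=> [[fW Sf]|[g Sg fg]]; first by exists (restriction fW).
have fW : preserves W f.
  by move=> v vW; have /= -> := fg (SubspaceType vW); exact: valP.
exists fW; suff -> : restriction fW = g by [].
by apply: Lin_eqP => w; apply: val_inj; rewrite /= -fg.
Qed.

Lemma Lin_restr_extension S g : S g ->
  exists2 f, Lin_restr S f & forall w, f (val w) = val (g w).
Proof.
move=> Sg; have [P PK] := subspace_projection.
pose f : Lin V := val \o (g \o P).
have fg w : f (val w) = val (g w) by rewrite /f /= PK.
by exists f => //; apply/Lin_restrP; exists g.
Qed.

Lemma Lin_extension_hitting g (w : sW) : (exists v, v \notin W) ->
  exists (f : Lin V) v, (forall x : sW, f (val x) = val (g x)) /\ f v = val w.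
Proof.
move=> [v vW]; have [P PK] := subspace_projection.
(* The component of [v] in the kernel of [P], nonzero because [v] is outside [W]. *)
pose v0 := v - val (P v).
have v0_neq0 : v0 != 0.
  by apply: contraNneq vW => /subr0_eq ->; exact: valP.
have [phi phiv0] := linear_functional_at v0_neq0.
pose Q : {linear V -> V} := idfun \- (val \o P).
have QK (x : sW) : Q (val x) = 0 by rewrite /Q /= PK subrr.
(* The rank-one term vanishes on [W] and takes [v0] to [w]. *)
pose h x := val (g (P x)) + phi (Q x) *: val w.
have hl : linear h.
  move=> a x y; rewrite /h !linearP.
  by rewrite scalerDl scalerDr scalerA addrACA.
pose f : Lin V :=
  HB.pack_for {linear V -> V} h (GRing.isLinear.Build F V V _ h hl).
exists f, v0; split=> [x|]; rewrite /f /= /h.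
  by rewrite PK QK linear0 scale0r addr0.
have Pv0 : P v0 = 0 by rewrite linearB PK subrr.
have -> : Q v0 = v0 by rewrite -[Q v0]/(v0 - val (P v0)) Pv0 linear0 addr0.
by rewrite Pv0 !linear0 phiv0 scale1r add0r.
Qed.

Lemma subsemigroup_Lin_restr S : subsemigroup S -> subsemigroup (Lin_restr S).
Proof.
move=> [[g Sg] Sm]; split.
  by have [f Sf _] := Lin_restr_extension Sg; exists f.
move=> f1 f2 /Lin_restrP[g1 Sg1 fg1] /Lin_restrP[g2 Sg2 fg2].
apply/Lin_restrP; exists (g1 * g2)%g; first exact: Sm.
by move=> w; rewrite /= fg1 fg2.
Qed.

(** * Necessity: consequences of regularity for [S] *)

Lemma regular_restr S g f : regular_semigroup (Lin_restr S) -> S g ->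
  (forall w, f (val w) = val (g w)) ->
  exists (b : Lin V) g', [/\ S g', forall w, b (val w) = val (g' w) &
    (f * b * f = f)%g].
Proof.
move=> [_ reg] Sg fg; have [|b /Lin_restrP[g' Sg' bg'] fbf] := reg f.
  by apply/Lin_restrP; exists g.
by exists b, g'.
Qed.

Lemma regular_of_Lin_restr S : subsemigroup S ->
  regular_semigroup (Lin_restr S) -> regular_semigroup S.
Proof.
move=> hS reg; split=> // g Sg; have [f _ fg] := Lin_restr_extension Sg.
have [b [g' [Sg' bg' fbf]]] := regular_restr reg Sg fg.
exists g' => //; apply: Lin_eqP => w; apply: val_inj => /=.
have : f (b (f (val w))) = f (val w) by rewrite -[in RHS]fbf.
by rewrite fg bg' fg.
Qed.

Lemma surjective_of_Lin_restr S g (w : sW) : (exists v, v \notin W) ->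
  regular_semigroup (Lin_restr S) -> S g -> exists w', g w' = w.
Proof.
move=> nW reg Sg; have [f [v [fg fv]]] := Lin_extension_hitting g w nW.
have [b [g' [_ bg' fbf]]] := regular_restr reg Sg fg.
(* On underlying vectors, [w = f v = f (b (f v)) = f (b w) = g (g' w)]. *)
exists (g' w); apply: val_inj; rewrite -fg -bg' -fv.
by rewrite -[in RHS]fbf.
Qed.

Lemma subgroup_of_Lin_restr S : subsemigroup S -> (exists v, v \notin W) ->
  regular_semigroup (Lin_restr S) -> subgroup_of (@LinAut F sW) S.
Proof.
move=> hS nW reg; have [[[g0 Sg0] Sm] Sreg] := regular_of_Lin_restr hS reg.
have left_inverse g : S g -> exists2 g', S g' & cancel g' g.
  move=> Sg; have [g' Sg' gg'g] := Sreg g Sg; exists g' => // w.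
  have [w' <-] := surjective_of_Lin_restr w nW reg Sg.
  by rewrite -[in RHS]gg'g.
have inverse g : S g -> exists2 g', S g' & cancel g' g /\ cancel g g'.
  move=> Sg; have [g' Sg' g'K] := left_inverse g Sg.
  exists g' => //; split=> // w.
  (* Being in [S], [g'] is onto, so the one-sided inverse is two-sided. *)
  by have [w' <-] := surjective_of_Lin_restr w nW reg Sg'; rewrite g'K.
split=> //.
- by move=> g /inverse[g' _ [g'K gK]]; exists g'.
- have [g' Sg' [g'K _]] := inverse _ Sg0.
  suff <- : (g' * g0 = 1)%g by exact: Sm.
  exact: Lin_eqP.
- move=> g /inverse[g' Sg' [g'K gK]]; exists g' => //.
  by split; apply: Lin_eqP.
Qed.

(** * Sufficiency of the two conditions *)

Lemma regular_Lin_restr_group S : subgroup_of (@LinAut F sW) S ->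
  regular_semigroup (Lin_restr S).
Proof.
move=> [_ S1 Sm Sinv]; split.
  by apply: subsemigroup_Lin_restr; split=> //; exists 1%g.
move=> f /Lin_restrP[g Sg fg]; have [g' Sg' [_ g'g]] := Sinv g Sg.
have g'K w : g (g' w) = w by rewrite -[RHS]/((1 : Lin sW)%g w) -g'g.
have [P PK] := subspace_projection.
have [c cf] := linear_ginv (f : {linear V -> V}).
pose Q : {linear V -> V} := idfun \- (val \o P).
have QK (x : sW) : Q (val x) = 0 by rewrite /Q /= PK subrr.
pose h x := val (g' (P x)) + c (Q x).
have hl : linear h by move=> a x y; rewrite /h !linearP scalerDr addrACA.
pose b : Lin V :=
  HB.pack_for {linear V -> V} h (GRing.isLinear.Build F V V _ h hl).
exists b.
  apply/Lin_restrP; exists g' => // w.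
  by rewrite /b /= /h PK QK linear0 addr0.
apply: Lin_eqP => x; rewrite /= /h linearD fg g'K !linearB cf.
(* [W] is contained in the image of [f], so [c] inverts [f] there too. *)
have -> : f (c (val (P (f x)))) = val (P (f x)).
  by rewrite -[in LHS](g'K (P (f x))) -fg cf fg g'K.
by rewrite addrC subrK.
Qed.

Lemma regular_Lin_restr_full S : (forall v, v \in W) ->
  regular_semigroup S -> regular_semigroup (Lin_restr S).
Proof.
move=> WV [hS Sreg]; split; first exact: subsemigroup_Lin_restr.
move=> f /Lin_restrP[g Sg fg]; have [g' Sg' gg'g] := Sreg g Sg.
have [b Sb bg'] := Lin_restr_extension Sg'.
(* Every [v] lies in [W], so the identity for [g] and [g'] transfers pointwise to [f] and [b]. *)
exists b => //; apply: Lin_eqP => v.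
have /= fgv := fg (SubspaceType (WV v)).
rewrite /= fgv bg' fg -[in RHS]gg'g; congr val.
Qed.

End Restriction.

Theorem theorem4p4 (F : fieldType) (V : lmodType F) (W : submodClosed V)
    (S : set (Lin (subspace_type W))) (hS : subsemigroup S) :
  regular_semigroup (Lin_restr S) <->
  subgroup_of (@LinAut F (subspace_type W)) S \/
  (regular_semigroup S /\ forall v : V, v \in W).
Proof.
split=> [reg|[|[Sreg WV]]].
- have [WV|nWV] := pselect (forall v : V, v \in W).
    by right; split=> //; exact: regular_of_Lin_restr reg.
  left; apply: subgroup_of_Lin_restr => //.
  by move/existsNP: nWV => [v /negP vW]; exists v.
- exact: regular_Lin_restr_group.
- exact: regular_Lin_restr_full.
Qed.
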